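(* Let $v,w\in W^P$ with corresponding Maya diagrams $M^v$ and $M^w$. Let $\mathcal C$ be any chain from $v$ to $w$, with degree $\deg_{\mathcal C}(v,w)\in\mathbb Z^k$. Then, componentwise, $$(\deg_1(v,w),\dots,\deg_k(v,w))\le \deg_{\mathcal C}(v,w).$$
   Context: **Setting.** Fix integers $0=i_0<i_1<\cdots<i_k<i_{k+1}=n$. Let $W=S_n$, written in one-line notation; $s_{e_l-e_m}$ ($l<m$) is the transposition $(l\,m)$, so $ws_{e_l-e_m}$ is obtained from $w$ by interchanging the entries in positions $l$ and $m$. Let $s_l=s_{e_l-e_{l+1}}$ and $W_P=\langle s_l: l\notin\{i_1,\dots,i_k\}\rangle$. $W^P$ is the set of minimal length representatives of $W/W_P$, i.e. permutations $w$ with $w(i_{j-1}+1)<\cdots<w(i_j)$ for $1\le j\le k+1$. It carries the Bruhat order $\le$. **Chains and degrees.** Unequal $u,u'\in W^P$ are adjacent if $u'W_P=us_{e_l-e_m}W_P$ for some reflection $s_{e_l-e_m}$, $l<m$. If $i_{a-1}+1\le l\le i_a$ and $i_{b-1}+1\le m\le i_b$ (necessarily $a<b$), the degree is $d(u,u')=(0^{a-1},1^{b-a},0^{k+1-b})\in\mathbb Z^k$ (exponents denote repetition). A chain $\mathcal C$ from $v$ to $w$ is a sequence $u_0,\dots,u_r$ in $W^P$ with consecutive elements adjacent, $u_0\le v$ and $w\le u_r$; its degree is $\deg_{\mathcal C}(v,w)=\sum_{i=1}^r d(u_{i-1},u_i)$. **Maya diagrams.** The Maya diagram $M^w$ of $w\in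 W^P$ is a grid with rows $1,\dots,k+1$ (row $1$ at the bottom) and columns $1,\dots,n$, with an $x$ in position $(y,z)$ iff $z\in\{w(1),\dots,w(i_y)\}$. Row $y$ is denoted $m_y^w$. Let $S_y(M,z)$ be the number of $x$'s in row $y$ of $M$ in columns $1,\dots,z$. Write $M^w\le M^v$ if $S_y(M^w,z)\ge S_y(M^v,z)$ for all rows $y$ and all $1\le z\le n$. **The numbers $\deg_y(v,w)$.** Let $1\le y\le k$ and let $\pi_y:W^P\to W^{P_{i_y}}$ be the natural projection to the Grassmannian case (flag indices $0<i_y<n$), so $M^{\pi_y(v)}$ is the two-row diagram with an $x$ in every column of the top row and with bottom row $m_y^v$. The $(1,2)$-rim hook rule in this two-row setting removes the smallest-column $x$ of the bottom row and then adds an $x$ in the largest column of the bottom row that is empty at that moment. Then $\deg_y(v,w)$ is the smallest integer $D\ge0$ such that, after applying the $(1,2)$-rim hook rule $D$ times starting from $M^{\pi_y(v)}$, the resulting diagram is $\ge M^{\pi_y(w)}$, none of the earlier ones being so. *)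

(* Defs.v *)
From mathcomp Require Import all_boot all_order all_fingroup all_algebra.
From mathcomp Require Import zify.

Set Implicit Arguments.
Unset Strict Implicit.
Unset Printing Implicit Defensive.

Import Order.TTheory GRing.Theory Num.Theory.
Local Open Scope nat_scope.

(* Conventions.
   - Positions, values and columns 1, ..., n are the elements 0, ..., n-1 of
     'I_n; thus the positions 1, ..., i_j are the x : 'I_n with x < i j.
   - The flag indices i_0, ..., i_{k+1} are the values i 0, ..., i k.+1 of a
     function i : nat -> nat (its other values are irrelevant).
   - Rows 1, ..., k+1 are the elements 0, ..., k of 'I_k.+1, and an index
     1 <= y <= k is an element of 'I_k, so i_y is written i y.+1.
   - MathComp composes permutations from left to right: (s * t) x = t (s x).
     The product w s_{e_l-e_m} of the text, i.e. w with the entries in positions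
     l and m interchanged, is therefore (tperm l m * w)%g, and the coset w W_P
     is the right coset WP :* w. *)

Definition flag_indices (k n : nat) (i : nat -> nat) : Prop :=
  [/\ i 0 = 0, forall j, j <= k -> i j < i j.+1 & i k.+1 = n].

Definition perm_length n (w : 'S_n) : nat :=
  #|[set p : 'I_n * 'I_n | (p.1 < p.2) && (w p.2 < w p.1)]|.

Definition bruhat_step n (u w : 'S_n) : bool :=
  [exists l : 'I_n, exists m : 'I_n,
     (w == (tperm l m * u)%g) && (perm_length u < perm_length w)].

Definition bruhat_le n (u w : 'S_n) : bool := connect (@bruhat_step n) u w.

(* The simple reflection exchanging the 0-based positions l and m = l + 1 is
   s_m in 1-based numbering. *)
Definition parabolic (k n : nat) (i : nat -> nat) : {group 'S_n} :=
  <<[set tperm p.1 p.2 | p : 'I_n * 'I_n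
      & (p.2 == p.1.+1 :> nat) && [forall j : 'I_k, i j.+1 != p.2]]>>%G.

Definition min_reps (k n : nat) (i : nat -> nat) : {set 'S_n} :=
  [set w : 'S_n | [forall j : 'I_k.+1, forall x : 'I_n, forall y : 'I_n,
      [&& i j <= x, x < y & y < i j.+1] ==> (w x < w y)]].

Definition adjacent (k n : nat) (i : nat -> nat) (u u' : 'S_n) : bool :=
  (u != u') &&
  [exists l : 'I_n, exists m : 'I_n, (l < m) &&
     (parabolic k n i :* u' == parabolic k n i :* (tperm l m * u))%g].

(* (l, m) is a reflection relating the cosets of u and u', with l in block a and
   m in block b (blocks being numbered from 0). *)
Definition reflection_in_blocks (k n : nat) (i : nat -> nat) (u u' : 'S_n)
    (l m : 'I_n) (a b : 'I_k.+1) : bool :=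
  [&& l < m, i a <= l < i a.+1, i b <= m < i b.+1
    & (parabolic k n i :* u' == parabolic k n i :* (tperm l m * u))%g].

(* (0^{a-1}, 1^{b-a}, 0^{k+1-b}) for the 1-based blocks a, b. *)
Definition block_degree (k : nat) (a b : 'I_k.+1) : 'rV[int]_k :=
  (\row_(y < k) (a <= y < b)%N%:R)%R.

(* The choice of reflection is immaterial, see step_degreeE below; the value 0 is
   never used on adjacent elements, see adjacent_blocks. *)
Definition step_degree (k n : nat) (i : nat -> nat) (u u' : 'S_n) :
    'rV[int]_k :=
  if [pick q : ('I_n * 'I_n) * ('I_k.+1 * 'I_k.+1)
      | reflection_in_blocks i u u' q.1.1 q.1.2 q.2.1 q.2.2] is Some q
  then block_degree q.2.1 q.2.2 else 0%R.

(* The sequence u_0, u_1, ..., u_r is u0 :: us. *)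
Definition is_chain (k n : nat) (i : nat -> nat) (v w u0 : 'S_n)
    (us : seq 'S_n) : Prop :=
  [/\ all (fun u => u \in min_reps k n i) (u0 :: us),
      path (@adjacent k n i) u0 us,
      bruhat_le u0 v & bruhat_le w (last u0 us)].

Definition chain_degree (k n : nat) (i : nat -> nat) (u0 : 'S_n)
    (us : seq 'S_n) : 'rV[int]_k :=
  (\sum_(p <- zip (u0 :: us) us) step_degree k i p.1 p.2)%R.

Lemma parabolic_block k n (i : nat -> nat) (h : 'S_n) (j : 'I_k) (x : 'I_n) :
  h \in parabolic k n i -> (h x < i j.+1) = (x < i j.+1).
Proof.
set S := [set x : 'I_n | x < i j.+1].
have sub : parabolic k n i \subset 'N(S | 'P)%g.
  rewrite gen_subG; apply/subsetP=> _ /imsetP[[l m] + ->].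
  rewrite !inE /= => /andP[/eqP mE /forallP/(_ j) neq].
  apply/subsetP=> z; rewrite !inE /= /aperm.
  by case: tpermP => [->|->|//]; move: neq; lia.
by move/(subsetP sub) => hN; have := astabs_act x hN; rewrite !inE.
Qed.

Lemma step_degreeE k n (i : nat -> nat) (u u' : 'S_n) (l m : 'I_n)
    (a b : 'I_k.+1) :
    flag_indices k n i -> reflection_in_blocks i u u' l m a b ->
  step_degree k i u u' = block_degree a b.
Proof.
move=> [_ inc _] rlm; rewrite /step_degree.
case: pickP => [[[l2 m2] [a2 b2]] /= r2 | /(_ ((l, m), (a, b)))]; last first.
  by rewrite rlm.
have mono j1 j2 : j1 <= j2 <= k.+1 -> i j1 <= i j2.
  elim: j2 => [|j2 IH]; first by rewrite leqn0 => /andP[/eqP->].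
  case/andP; rewrite leq_eqVlt => /orP[/eqP-> // | lt12 le2].
  have le12 : i j1 <= i j2 by apply: IH; lia.
  exact: leq_trans le12 (ltnW (inc _ le2)).
have blk (x : 'I_n) (c : 'I_k.+1) (y : 'I_k) : i c <= x < i c.+1 ->
    (x < i y.+1) = (c <= y).
  move=> /andP[lo hi]; have := ltn_ord c; have := ltn_ord y => yk ck.
  apply/idP/idP => H.
    rewrite leqNgt; apply/negP=> yc.
    have : i y.+1 <= i c by apply: mono; lia.
    lia.
  have : i c.+1 <= i y.+1 by apply: mono; lia.
  lia.
have moved (l0 m0 : 'I_n) (a0 b0 : 'I_k.+1) (x : 'I_n) (y : 'I_k) :
    reflection_in_blocks i u u' l0 m0 a0 b0 ->
    (u'^-1%g (u x) < i y.+1) = (tperm l0 m0 x < i y.+1).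
  case/and4P=> _ _ _ /eqP eqc.
  have : u' \in (parabolic k n i :* (tperm l0 m0 * u))%g.
    by rewrite -eqc rcoset_refl.
  case/rcosetP=> h hP u'E; set p := (u'^-1%g (u x)).
  have u'p : u' p = u x by rewrite permKV.
  rewrite -(parabolic_block y p hP); congr (_ < _); congr val.
  apply: (can_inj (tpermK l0 m0)); apply: (@perm_inj _ u).
  by rewrite tpermK -u'p u'E !permM.
have transfer (l0 m0 l1 m1 : 'I_n) (a0 b0 a1 b1 : 'I_k.+1) (y : 'I_k) :
    reflection_in_blocks i u u' l0 m0 a0 b0 ->
    reflection_in_blocks i u u' l1 m1 a1 b1 ->
    a0 <= y < b0 -> a1 <= y < b1.
  move=> r0 r1; have := moved _ _ _ _ l0 y r0; rewrite (moved _ _ _ _ l0 y r1).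
  case/and4P: r0 => lt0 bl0 bm0 _; case/and4P: r1 => lt1 bl1 bm1 _.
  rewrite tpermL (blk _ _ y bm0) => eqt /andP[a0y yb0].
  move: eqt; rewrite [RHS]leqNgt yb0 /=.
  move: (blk _ _ y bl1) (blk _ _ y bm1) (blk _ _ y bl0).
  by case: tpermP => [->|->|_ _]; lia.
apply/rowP=> y; rewrite !mxE; congr (_%:R)%R; congr nat_of_bool.
by apply/idP/idP; [apply: transfer r2 rlm | apply: transfer rlm r2].
Qed.

Lemma adjacent_blocks k n (i : nat -> nat) (u u' : 'S_n) :
    flag_indices k n i -> adjacent k i u u' ->
  exists l m a b, @reflection_in_blocks k n i u u' l m a b.
Proof.
move=> [i0 inc ik] /andP[_ /existsP[l /existsP[m /andP[lm eqc]]]].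
have blk (x : 'I_n) : exists a : 'I_k.+1, i a <= x < i a.+1.
  have ex : exists j, x < i j.+1 by exists k; rewrite ik.
  case: (ex_minnP ex) => a xa amin.
  have ak : a < k.+1 by rewrite ltnS amin // ik.
  exists (Ordinal ak) => /=; rewrite xa andbT.
  case: a xa amin ak => [|a] xa amin ak; first by rewrite i0.
  by rewrite leqNgt; apply/negP=> /amin; rewrite ltnn.
have [a la] := blk l; have [b mb] := blk m.
by exists l, m, a, b; apply/and4P.
Qed.

(* A diagram with r rows and n columns is the set of positions of its x's. *)
Definition diagram (r n : nat) := {set 'I_r * 'I_n}.

Definition maya (k n : nat) (i : nat -> nat) (w : 'S_n) : diagram k.+1 n :=
  [set p : 'I_k.+1 * 'I_n | p.2 \in [set w x | x : 'I_n & x < i p.1.+1]].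

Definition row_count r n (M : diagram r n) (y : 'I_r) (z : 'I_n) : nat :=
  #|[set c : 'I_n | (c <= z) && ((y, c) \in M)]|.

Definition maya_le r n (M M' : diagram r n) : bool :=
  [forall y : 'I_r, forall z : 'I_n, row_count M' y z <= row_count M y z].

Definition grassmannian_indices (n m : nat) : nat -> nat := nth n [:: 0; m].

Definition grassmannian_proj (n m : nat) (w : 'S_n) : 'S_n :=
  [arg min_(u < w in (parabolic 1 n (grassmannian_indices n m) :* w)%g)
     perm_length u].

Definition rim_hook12 n (M : diagram 2 n) : diagram 2 n :=
  if [pick c | ((ord0, c) \in M)
             && [forall c', ((ord0, c') \in M) ==> (c <= c')]] is Some lo then
    let M1 := M :\ (ord0, lo) in
    if [pick c | ((ord0, c) \notin M1)
               && [forall c', ((ord0, c') \notin M1) ==> (c' <= c)]] is Some hi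
    then (ord0, hi) |: M1 else M1
  else M.

Definition grassmannian_maya n (m : nat) (w : 'S_n) : diagram 2 n :=
  maya 1 (grassmannian_indices n m) (grassmannian_proj m w).

Definition degree_reached n (m : nat) (v w : 'S_n) (D : nat) : bool :=
  maya_le (grassmannian_maya m w)
          (iter D (@rim_hook12 n) (grassmannian_maya m v)).

Definition bottom_row n (M : diagram 2 n) : {set 'I_n} :=
  [set c | (ord0, c) \in M].

Lemma rim_hook12_empty n (M : diagram 2 n) :
  bottom_row M = set0 -> rim_hook12 M = M.
Proof.
move=> M0; rewrite /rim_hook12; case: pickP => // c /andP[cM _].
by move/setP/(_ c): M0; rewrite !inE cM.
Qed.

Lemma rim_hook12E n (M : diagram 2 n) : bottom_row M != set0 ->
  exists lo hi : 'I_n,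
    [/\ (ord0, lo) \in M, forall c, (ord0, c) \in M -> lo <= c,
        (ord0, hi) \notin M :\ (ord0, lo),
        forall c, (ord0, c) \notin M :\ (ord0, lo) -> c <= hi
      & rim_hook12 M = (ord0, hi) |: (M :\ (ord0, lo))].
Proof.
case/set0Pn=> c0; rewrite inE => c0M; rewrite /rim_hook12.
case: pickP => [lo /andP[loM /forallP lomin] | no_lo]; last first.
  case: (@arg_minnP _ c0 (fun c => (ord0, c) \in M) val c0M) => lo loM lomin.
  have /negP[] := negbT (no_lo lo); rewrite loM /=.
  by apply/forallP=> c; apply/implyP=> /lomin.
exists lo; set M1 := M :\ (ord0, lo).
have lo1 : (ord0, lo) \notin M1 by rewrite !inE eqxx.
case: pickP => [hi /andP[hiM /forallP himax] | no_hi]; last first.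
  case: (@arg_maxnP _ lo (fun c => (ord0, c) \notin M1) val lo1) => hi hiM himax.
  have /negP[] := negbT (no_hi hi); rewrite hiM /=.
  by apply/forallP=> c; apply/implyP=> /himax.
exists hi; split=> // c; first by move/(implyP (lomin c)).
by move/(implyP (himax c)).
Qed.

Lemma rim_hook12_top n (M : diagram 2 n) (c : 'I_n) :
  ((ord_max, c) \in rim_hook12 M) = ((ord_max, c) \in M).
Proof.
have [/rim_hook12_empty -> // | /rim_hook12E[lo [hi [_ _ _ _ ->]]]] :=
  eqVneq (bottom_row M) set0.
by rewrite !inE !xpair_eqE.
Qed.

Lemma top_justified_le n (M N : diagram 2 n) (lo : 'I_n) :
    #|bottom_row M| = #|bottom_row N| ->
    (forall c : 'I_n, ((ord_max, c) \in M) = ((ord_max, c) \in N)) ->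
    (forall c : 'I_n, ((ord0, c) \in M) = (lo <= c)) ->
  maya_le N M.
Proof.
move=> eqc eqt Mlo; apply/forallP=> y; apply/forallP=> z.
have [->|->] : y = ord0 \/ y = ord_max.
  by case: y => [[|[|//]] ?]; [left | right]; apply: val_inj.
- have splitE (P : diagram 2 n) : #|bottom_row P| = row_count P ord0 z
      + #|[set c : 'I_n | (z < c) && ((ord0, c) \in P)]|.
    rewrite -(cardsID [set c : 'I_n | c <= z] (bottom_row P)); congr addn.
      by apply: eq_card => c; rewrite !inE andbC.
    by apply: eq_card => c; rewrite !inE -ltnNge.
  have [lt_z_lo|le_lo_z] := ltnP z lo.
    by rewrite [leqLHS]eq_card0 // => c; rewrite !inE Mlo; lia.
  have leA : #|[set c : 'I_n | (z < c) && ((ord0, c) \in N)]|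
          <= #|[set c : 'I_n | (z < c) && ((ord0, c) \in M)]|.
    apply: subset_leq_card; apply/subsetP=> c; rewrite !inE Mlo.
    by case/andP=> ltzc _; rewrite ltzc (leq_trans le_lo_z) // ltnW.
  by move: eqc; rewrite !splitE; lia.
- rewrite /row_count; apply: subset_leq_card; apply/subsetP=> c.
  by rewrite !inE eqt.
Qed.

Lemma rim_hook12_reaches n (M N : diagram 2 n) :
    #|bottom_row M| = #|bottom_row N| ->
    (forall c : 'I_n, ((ord_max, c) \in M) = ((ord_max, c) \in N)) ->
  exists D, maya_le N (iter D (@rim_hook12 n) M).
Proof.
pose f (P : diagram 2 n) := \sum_(c in bottom_row P) (n - c).
have [b] := ubnP (f M); elim: b M => // b IHb M; rewrite ltnS => leb eqc eqt.
have [M0 | M_n0] := eqVneq (bottom_row M) set0.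
  exists 0; apply/forallP=> y; apply/forallP=> z /=.
  have [->|->] : y = ord0 \/ y = ord_max.
    by case: y => [[|[|//]] ?]; [left | right]; apply: val_inj.
    rewrite [leqLHS]eq_card0 // => c.
    by move/setP/(_ c): M0; rewrite !inE => ->; rewrite andbF.
  by rewrite /row_count; apply: subset_leq_card; apply/subsetP=> c;
     rewrite !inE eqt.
have [lo [hi [loM lomin hiM himax hookE]]] := rim_hook12E M_n0.
have lehi : lo <= hi by apply: himax; rewrite !inE eqxx.
have [eqlh | neqlh] := eqVneq hi lo.
  exists 0; apply: (@top_justified_le _ _ _ lo) => // c.
  apply/idP/idP=> [/lomin // | le_lo_c]; apply: contraT => cM.
  have := himax c; rewrite !inE (negbTE cM) andbF => /(_ isT).
  rewrite eqlh => le_c_lo; have eqc' : c = lo by apply: val_inj => /=; lia.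
  by rewrite eqc' loM in cM.
have botE : bottom_row (rim_hook12 M) = hi |: (bottom_row M :\ lo).
  by apply/setP=> c; rewrite hookE !inE !xpair_eqE /=.
have hi1 : hi \notin bottom_row M :\ lo by move: hiM; rewrite !inE xpair_eqE eqxx.
have lo1 : lo \in bottom_row M by rewrite inE.
have [D reachD] : exists D, maya_le N (iter D (@rim_hook12 n) (rim_hook12 M)).
  apply: IHb.
  - apply: leq_trans leb; rewrite /f botE big_setU1 //= (big_setD1 lo lo1) /=.
    rewrite ltn_add2r; have := ltn_ord hi.
    by move: neqlh lehi; rewrite -val_eqE /=; lia.
  - by rewrite -eqc botE cardsU1 hi1 (cardsD1 lo (bottom_row M)) lo1.
  - by move=> c; rewrite rim_hook12_top.
by exists D.+1; rewrite iterSr.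
Qed.

Lemma degree_reached_ex n (m : nat) (v w : 'S_n) :
  exists D, degree_reached m v w D.
Proof.
apply: rim_hook12_reaches => [|c].
  have cardE (u : 'S_n) : #|[set c : 'I_n | (ord0, c) \in
      maya 1 (grassmannian_indices n m) u]| = #|[set x : 'I_n | x < m]|.
    rewrite -[RHS](card_imset _ (@perm_inj _ u)); apply: eq_card => c.
    rewrite !inE /=.
    by apply/imsetP/imsetP=> -[x xm ->]; exists x => //; rewrite !inE in xm *.
  by rewrite !cardE.
have topE (u : 'S_n) :
    (ord_max, c) \in maya 1 (grassmannian_indices n m) u.
  rewrite inE /=; apply/imsetP; exists (u^-1%g c); last by rewrite permKV.
  by rewrite inE /grassmannian_indices /= ltn_ord.
by rewrite !topE.
Qed.

(* deg_y(v, w) is deg (i y) v w: it depends on y only through i_y. *)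
Definition deg n (m : nat) (v w : 'S_n) : nat :=
  ex_minn (degree_reached_ex m v w).

(* Main.v *)
Require Import Defs.
From mathcomp Require Import all_boot all_order all_fingroup all_algebra.
From mathcomp Require Import zify.

Set Implicit Arguments.
Unset Strict Implicit.
Unset Printing Implicit Defensive.

Import Order.TTheory GRing.Theory Num.Theory.
Local Open Scope nat_scope.

(* Fix y, put m = i_y, and let c_u(z) be the number of x's in row y of M^u in
   columns 1, ..., z.  Going up in Bruhat order can only decrease c_u(z), and a
   step of the chain decreases it by at most the y-th entry of its degree; hence
   c_w(z) >= c_v(z) - D, where D is the y-th entry of the degree of the chain.
   On the other side, the rim hook rule decreases the count in columns 1, ..., z
   by one (or keeps it at 0) unless the columns after z are full, in which case
   the count is the least possible one for m x's. So after D applications to the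
   row of v the counts are at most c_w(z). *)

(** * Row counts and the Bruhat order *)

Definition count_le n (m : nat) (u : 'S_n) (z : 'I_n) : nat :=
  #|[set x : 'I_n | (x < m) && (u x <= z)]|.

(** Left multiplication by [p] only rearranges the first [m] positions. This serves both for
    parabolic factors and for swaps on one side of [m]. *)
Lemma count_le_mull n (m : nat) (p u : 'S_n) (z : 'I_n) :
    (forall x : 'I_n, (p x < m) = (x < m)) ->
  count_le m (p * u)%g z = count_le m u z.
Proof.
move=> pm; rewrite /count_le -(card_imset _ (@perm_inj _ p)).
apply: eq_card => x; apply/imsetP/idP => [[x' + ->]|].
  by rewrite !inE permM pm.
rewrite inE => H; exists (p^-1%g x); last by rewrite permKV.
by rewrite inE permM -pm permKV.
Qed.

Lemma tperm_same_side n (m : nat) (l l' x : 'I_n) :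
  (l < m) = (l' < m) -> (tperm l l' x < m) = (x < m).
Proof. by case: tpermP => [-> ->|-> ->|]. Qed.

Lemma perm_length_tperm n (u : 'S_n) (l m : 'I_n) :
  l < m -> u m < u l -> perm_length (tperm l m * u)%g <= perm_length u.
Proof.
move=> lm ult; set t := tperm l m.
(* An injection from the inversions of [t * u] to those of [u]: move both ends by [t], unless that
   reverses their order. *)
pose f (p : 'I_n * 'I_n) := if t p.1 < t p.2 then (t p.1, t p.2) else p.
have f_inj : {in [set p : 'I_n * 'I_n | p.1 < p.2] &, injective f}.
  move=> [p q] [p' q']; rewrite !inE /f /= => pq pq'.
  case: ifP => H; case: ifP => H' [].
  - by move=> /perm_inj -> /perm_inj ->.
  - by move=> E1 E2; move: H'; rewrite -E1 -E2 /t !tpermK pq.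
  - by move=> E1 E2; move: H; rewrite E1 E2 /t !tpermK pq'.
  - by move=> -> ->.
rewrite /perm_length -(card_in_imset (f := f)); last first.
  move=> p q; rewrite !inE => /andP[Hp _] /andP[Hq _].
  by apply: f_inj; rewrite inE.
apply: subset_leq_card; apply/subsetP=> _ /imsetP[[p q] + ->].
rewrite !inE /f !permM /=; case: ifP => /= [-> /andP[] //|].
move=> /negbT H /andP[pq inv]; rewrite pq /=; move: H inv.
rewrite /t; case: tpermP => [Ep|Ep|_ _]; case: tpermP => [Eq|Eq|_ _] //;
  subst; lia.
Qed.

Lemma bruhat_step_count_le n (m : nat) (u w : 'S_n) (z : 'I_n) :
  bruhat_step u w -> count_le m w z <= count_le m u z.
Proof.
case/existsP=> l /existsP[l' /andP[/eqP-> {w}]].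
wlog ll : l l' / l <= l'.
  by move=> H; case/orP: (leq_total l l') => [/H//|/H]; rewrite tpermC.
move: ll; rewrite leq_eqVlt => /orP[/eqP /val_inj ->|ll len].
  by rewrite tperm1 mul1g ltnn.
have ult : u l < u l'.
  rewrite ltnNge leq_eqVlt negb_or; apply/andP; split.
    by apply/eqP=> /val_inj/perm_inj E; rewrite E ltnn in ll.
  by apply/negP=> /(perm_length_tperm ll); rewrite leqNgt len.
have [same|diff] := eqVneq (l < m) (l' < m).
  by rewrite count_le_mull // => x; apply: tperm_same_side.
(* Now [l < m <= l'], so the swap puts the larger value [u l'] in place of [u l] among the first
   [m]. *)
apply: subset_leq_card; apply/subsetP=> x; rewrite !inE permM.
by case: tpermP => [->|->|]; lia.
Qed.

Lemma bruhat_le_count_le n (m : nat) (u w : 'S_n) (z : 'I_n) :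
  bruhat_le u w -> count_le m w z <= count_le m u z.
Proof.
case/connectP=> s; elim: s u => [|u' s IH] u /=; first by move=> _ ->.
case/andP=> /(bruhat_step_count_le m z) le1 /IH le2 /le2 {}le2.
exact: leq_trans le2 le1.
Qed.

(** * Row counts along a chain *)

Lemma flag_indices_mono k n (i : nat -> nat) (j1 j2 : nat) :
  flag_indices k n i -> j1 <= j2 <= k.+1 -> i j1 <= i j2.
Proof.
move=> [_ inc _]; elim: j2 => [|j2 IH]; first by rewrite leqn0 => /andP[/eqP->].
case/andP; rewrite leq_eqVlt => /orP[/eqP-> // | lt12 le2].
have le12 : i j1 <= i j2 by apply: IH; lia.
exact: leq_trans le12 (ltnW (inc _ le2)).
Qed.

Lemma lt_flag_index k n (i : nat -> nat) (x : nat) (c : 'I_k.+1) (y : 'I_k) :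
  flag_indices k n i -> i c <= x < i c.+1 -> (x < i y.+1) = (c <= y).
Proof.
move=> i_flag /andP[lo hi]; have := ltn_ord c; have := ltn_ord y => yk ck.
have [cy|yc] := leqP c y.
  by apply: leq_trans hi (flag_indices_mono i_flag _); lia.
have : i y.+1 <= i c by apply: (flag_indices_mono i_flag); lia.
lia.
Qed.

Lemma adjacent_count_le k n (i : nat -> nat) (u u' : 'S_n) (y : 'I_k)
    (z : 'I_n) :
    flag_indices k n i -> adjacent k i u u' ->
  (Posz (count_le (i y.+1) u z)
     <= Posz (count_le (i y.+1) u' z) + step_degree k i u u' ord0 y)%R.
Proof.
move=> i_flag /(adjacent_blocks i_flag)[l [l' [a [b r]]]].
rewrite (step_degreeE i_flag r) mxE; case/and4P: r => ll la lb /eqP eqc.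
have : u' \in (parabolic k n i :* (tperm l l' * u))%g.
  by rewrite -eqc rcoset_refl.
case/rcosetP=> h hP ->; rewrite count_le_mull => [|x]; last first.
  exact: parabolic_block hP.
have ly := lt_flag_index y i_flag la; have ly' := lt_flag_index y i_flag lb.
have [same|diff] := eqVneq (l < i y.+1) (l' < i y.+1).
  by rewrite count_le_mull => [|x]; [lia | apply: tperm_same_side].
(* The swap crosses [i y.+1], so this entry of the degree is 1. *)
have -> : (a <= y < b) by lia.
suff : count_le (i y.+1) u z <= (count_le (i y.+1) (tperm l l' * u)%g z).+1.
  lia.
set B := [set x : 'I_n | (x < i y.+1) && ((tperm l l' * u)%g x <= z)].
(* Of the positions counted for [u], only [l] can be lost. *)
have cardB : #|l |: B| <= #|B|.+1 by rewrite cardsU1; case: (l \in B).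
apply: leq_trans cardB.
apply: subset_leq_card; apply/subsetP=> x; rewrite !inE permM.
by case: tpermP => [->|->|/eqP/negbTE -> _ ->]; rewrite ?eqxx ?orbT //; lia.
Qed.

Lemma chain_count_le k n (i : nat -> nat) (u0 : 'S_n) (us : seq 'S_n)
    (y : 'I_k) (z : 'I_n) :
    flag_indices k n i -> path (@adjacent k n i) u0 us ->
  (Posz (count_le (i y.+1) u0 z)
     <= Posz (count_le (i y.+1) (last u0 us) z)
        + chain_degree k i u0 us ord0 y)%R.
Proof.
move=> i_flag; elim: us u0 => [|u us IH] u0 /=.
  by rewrite /chain_degree /= big_nil mxE addr0.
case/andP=> /(adjacent_count_le y z i_flag) le1 /IH le2.
rewrite /chain_degree /= big_cons mxE -/(chain_degree k i u us).
by rewrite addrCA; apply: le_trans le1 _; rewrite [leLHS]addrC lerD2l.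
Qed.

(** Allows the entry to be used as a number of rim hook applications. *)
Lemma chain_degree_ge0 k n (i : nat -> nat) (u0 : 'S_n) (us : seq 'S_n)
    (y : 'I_k) :
  (0 <= chain_degree k i u0 us ord0 y)%R.
Proof.
rewrite /chain_degree summxE; apply: sumr_ge0 => p _; rewrite /step_degree.
by case: pickP => [q _|_]; rewrite mxE.
Qed.

(** * Rows of the Grassmannian projection *)

Lemma grassmannian_proj_count_le n (m : nat) (w : 'S_n) (z : 'I_n) :
  count_le m (grassmannian_proj m w) z = count_le m w z.
Proof.
rewrite /grassmannian_proj; case: arg_minnP => [|u]; first exact: rcoset_refl.
case/rcosetP=> h hP -> _; apply: count_le_mull => x.
exact: (@parabolic_block 1 n (grassmannian_indices n m) h ord0 x hP).
Qed.

Lemma row_count_grassmannian n (m : nat) (w : 'S_n) (z : 'I_n) :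
  row_count (grassmannian_maya m w) ord0 z = count_le m w z.
Proof.
rewrite -grassmannian_proj_count_le /grassmannian_maya.
set u := grassmannian_proj m w.
rewrite /row_count /count_le -[RHS](card_imset _ (@perm_inj _ u)).
apply: eq_card => c; rewrite !inE; apply/idP/idP.
  case/andP=> cz /imsetP[x + E]; rewrite inE => xm.
  by apply/imsetP; exists x; rewrite // inE -E cz andbT.
case/imsetP=> x; rewrite inE => /andP[xm xz] ->; rewrite xz /=.
by apply/imsetP; exists x; rewrite ?inE.
Qed.

Lemma card_bottom_row_grassmannian n (m : nat) (w : 'S_n) :
  #|bottom_row (grassmannian_maya m w)| = #|[set x : 'I_n | x < m]|.
Proof.
rewrite -[RHS](card_imset _ (@perm_inj _ (grassmannian_proj m w))).
by apply: eq_card => c; rewrite !inE.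
Qed.

Lemma grassmannian_top_row n (m : nat) (w : 'S_n) (c : 'I_n) :
  (ord_max, c) \in grassmannian_maya m w.
Proof.
rewrite inE /=; apply/imsetP; exists ((grassmannian_proj m w)^-1%g c).
  by rewrite inE ltn_ord.
by rewrite permKV.
Qed.

(** * Row counts under the rim hook rule *)

Lemma card_bottom_rowE n (M : diagram 2 n) (z : 'I_n) :
  #|bottom_row M| = row_count M ord0 z
    + #|[set c : 'I_n | (z < c) && ((ord0, c) \in M)]|.
Proof.
rewrite -(cardsID [set c : 'I_n | c <= z] (bottom_row M)); congr addn.
  by apply: eq_card => c; rewrite !inE andbC.
by apply: eq_card => c; rewrite !inE -ltnNge.
Qed.

Lemma card_bottom_row_rim_hook12 n (M : diagram 2 n) :
  #|bottom_row (rim_hook12 M)| = #|bottom_row M|.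
Proof.
have [/rim_hook12_empty -> // | /rim_hook12E[lo [hi [loM _ hiM _ ->]]]] :=
  eqVneq (bottom_row M) set0.
have -> : bottom_row ((ord0, hi) |: M :\ (ord0, lo))
    = hi |: (bottom_row M :\ lo).
  by apply/setP=> c; rewrite !inE !xpair_eqE.
have hi1 : hi \notin bottom_row M :\ lo.
  by move: hiM; rewrite !inE xpair_eqE eqxx.
by rewrite cardsU1 hi1 (cardsD1 lo (bottom_row M)) inE loM.
Qed.

Lemma row_count_rim_hook12 n (M N : diagram 2 n) (D : nat) (z : 'I_n) :
    #|bottom_row M| = #|bottom_row N| ->
    row_count M ord0 z <= row_count N ord0 z + D.+1 ->
  row_count (rim_hook12 M) ord0 z <= row_count N ord0 z + D.
Proof.
move=> eqc leD; have eqc' := card_bottom_row_rim_hook12 M.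
have [M0 | M_n0] := eqVneq (bottom_row M) set0.
  have := card_bottom_rowE (rim_hook12 M) z.
  by rewrite eqc' M0 cards0; lia.
have [lo [hi [loM lomin hiM himax hookE]]] := rim_hook12E M_n0.
have [hi_z|z_hi] := leqP hi z.
  (* Every column after [z] is full once the rule is applied. Both rows have equally many x's, so
     the count up to [z] is at most that of [N]. *)
  have le_after : #|[set c : 'I_n | (z < c) && ((ord0, c) \in N)]|
      <= #|[set c : 'I_n | (z < c) && ((ord0, c) \in rim_hook12 M)]|.
    apply: subset_leq_card; apply/subsetP=> c; rewrite !inE hookE.
    case/andP=> zc _; rewrite zc /= in_setU.
    have : (ord0, c) \in M :\ (ord0, lo).
      by apply: contraTT zc => /himax; lia.
    by move=> ->; rewrite orbT.
  by move: eqc eqc'; rewrite !(card_bottom_rowE _ z); lia.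
(* The new x lies after [z], so up to [z] only [lo] can disappear; if [lo] is also after [z], the
   count is 0. *)
have rowE : [set c : 'I_n | (c <= z) && ((ord0, c) \in rim_hook12 M)]
    = [set c : 'I_n | (c <= z) && ((ord0, c) \in M)] :\ lo.
  apply/setP=> c; rewrite hookE !inE !xpair_eqE /=.
  case: (eqVneq c hi) => [-> /=|_]; last by rewrite andbCA.
  by rewrite leqNgt z_hi andbF.
rewrite /row_count rowE.
have [lo_z|z_lo] := leqP lo z.
  move: leD; rewrite {1}/row_count (cardsD1 lo) inE lo_z loM /= add1n.
  by rewrite addnS.
rewrite eq_card0 // => c; rewrite !inE.
by apply/negP=> /and3P[_ cz /lomin]; lia.
Qed.

Lemma maya_le_iter_rim_hook12 n (M N : diagram 2 n) (D : nat) :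
    #|bottom_row M| = #|bottom_row N| ->
    (forall c : 'I_n, ((ord_max, c) \in M) = ((ord_max, c) \in N)) ->
    (forall z : 'I_n, row_count M ord0 z <= row_count N ord0 z + D) ->
  maya_le N (iter D (@rim_hook12 n) M).
Proof.
elim: D M => [|D IH] M eqc eqt leD.
  apply/forallP=> y; apply/forallP=> z /=.
  have [->|->] : y = ord0 \/ y = ord_max.
    by case: y => [[|[|//]] ?]; [left | right]; apply: val_inj.
    by rewrite -[leqRHS]addn0.
  by apply: subset_leq_card; apply/subsetP=> c; rewrite !inE eqt.
rewrite iterSr; apply: IH => [|c|z].
- by rewrite card_bottom_row_rim_hook12.
- by rewrite rim_hook12_top.
- exact: row_count_rim_hook12.
Qed.

Theorem lemma4p18 (k n : nat) (i : nat -> nat)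
    (i_flag : flag_indices k n i)
    (v w : 'S_n) (vWP : v \in min_reps k n i) (wWP : w \in min_reps k n i)
    (u0 : 'S_n) (us : seq 'S_n) (chain_us : is_chain k i v w u0 us)
    (y : 'I_k) :
  (Posz (deg (i y.+1) v w) <= chain_degree k i u0 us ord0 y)%R.
Proof.
have [_ adj u0v wur] := chain_us; set m := i y.+1.
have := chain_degree_ge0 i u0 us y.
case DE : (chain_degree k i u0 us ord0 y) => [D|//] _.
suff reached : degree_reached m v w D.
  by rewrite /deg; case: ex_minnP => d _ /(_ D reached).
apply: maya_le_iter_rim_hook12 => [|c|z].
- by rewrite !card_bottom_row_grassmannian.
- by rewrite !grassmannian_top_row.
have := chain_count_le y z i_flag adj; rewrite !row_count_grassmannian DE -/m.
(* With c the count up to [z]: c(v) <= c(u0) <= c(last) + D <= c(w) + D. *)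
have := bruhat_le_count_le m z u0v; have := bruhat_le_count_le m z wur.
lia.
Qed.
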